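(* The class of all finite digraphs that contain a directed cycle is decided by an adaptive left $2$-query algorithm over $\mathbb{N}$, but not by any non-adaptive left $k$-query algorithm over $\mathbb{N}$, for any $k$.
   Context: Digraphs are finite structures $(V,R)$, $V\ne\varnothing$, $R\subseteq V\times V$; a directed cycle is a sequence of distinct vertices $a_0,\dots,a_{\ell-1}$ ($\ell\ge1$) with $(a_i,a_{i+1})\in R$ for $i<\ell-1$ and $(a_{\ell-1},a_0)\in R$. $\mathsf{FIN}$ is the class of all digraphs, $\hom(F,A)$ the number of homomorphisms $F\to A$. A non-adaptive left $k$-query algorithm over $\mathbb{N}$ is a pair $((F_1,\dots,F_k),X)$ with $F_i\in\mathsf{FIN}$, $X\subseteq\mathbb{N}^k$, deciding $\{D:(\hom(F_i,D))_{i=1}^k\in X\}$. For a set $\Sigma$, $\Sigma^{<\omega}$ is the set of finite strings over $\Sigma$; a subtree is a prefix-closed subset, a leaf an element with no proper extension. An adaptive left query algorithm over $\mathbb{N}$ is a function $G:\mathcal{T}\to\mathsf{FIN}\cup\{\mathsf{YES},\mathsf{NO}\}$, $\mathcal{T}\subseteq\mathbb{N}^{<\omega}$ a subtree, $G(\sigma)\in\{\mathsf{YES},\mathsf{NO}\}$ iff $\sigma$ is a leaf; its computation path on $A$ is the limit of $\sigma_0=\varepsilon$, $\sigma_{i+1}=\sigma_i$ if $G(\sigma_i)\in\{\mathsf{YES},\mathsf{NO}\}$, else $\sigma_{i+1}=\sigma_i\bullet\hom(G(\sigma_i),A)$; it must halt on all inputs and decides $\{A:G(\text{path of }A)=\mathsf{YES}\}$.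 It is an adaptive left $k$-query algorithm if all computation paths have length at most $k$. *)

(* Defs.v *)
From mathcomp Require Import all_boot.
Set Implicit Arguments.
Unset Strict Implicit.
Unset Printing Implicit Defensive.

Record digraph := Digraph {
  vertex :> finType;
  edge : rel vertex;
  vertex_nonempty : 0 < #|vertex|
}.

Definition digraph_class := digraph -> Prop.

Definition is_hom (F A : digraph) (f : {ffun F -> A}) : bool :=
  [forall x, forall y, edge x y ==> edge (f x) (f y)].

Definition hom (F A : digraph) : nat := #|[set f : {ffun F -> A} | is_hom f]|.

(* [ucycle] also holds of the empty sequence, hence the first conjunct; a
   one-element sequence is a cycle exactly when its vertex carries a loop. *)
Definition has_directed_cycle : digraph_class :=
  fun D => exists a : seq D, a <> [::] /\ ucycle (@edge D) a.

(* The queries are not a [k.-tuple digraph]: the universe of the tuple type is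
   strictly below that of finType. *)
Record nonadaptive_algorithm (k : nat) := NonadaptiveAlgorithm {
  queries : 'I_k -> digraph;
  accepting : k.-tuple nat -> Prop
}.

Definition nonadaptive_decides (k : nat) (N : nonadaptive_algorithm k)
    (C : digraph_class) : Prop :=
  forall D, C D <-> accepting N [tuple hom (queries N i) D | i < k].

Inductive label := Query of digraph | YES | NO.

Definition is_verdict (l : label) : Prop := l = YES \/ l = NO.

(* A function from a set of strings to labels is encoded as an option-valued
   function on all strings; its domain is the set of strings not sent to None. *)
Definition labelling := seq nat -> option label.

Definition in_domain (G : labelling) (s : seq nat) : Prop := G s <> None.

Definition is_subtree (T : seq nat -> Prop) : Prop :=
  forall s t, prefix s t -> T t -> T s.

Definition is_leaf (T : seq nat -> Prop) (s : seq nat) : Prop :=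
  T s /\ forall t, T t -> prefix s t -> t = s.

(* The value on [None] is irrelevant: a run that leaves the domain stays
   outside of it, so it does not count as halting below. *)
Definition run_step (G : labelling) (A : digraph) (s : seq nat) : seq nat :=
  if G s is Some (Query F) then rcons s (hom F A) else s.

Definition run (G : labelling) (A : digraph) (n : nat) : seq nat :=
  iter n (run_step G A) [::].

Definition computation_path (G : labelling) (A : digraph) (s : seq nat) : Prop :=
  exists n, forall m, n <= m -> run G A m = s.

Definition halts_on (G : labelling) (A : digraph) : Prop :=
  exists2 s, computation_path G A s & in_domain G s.

Record adaptive_algorithm := AdaptiveAlgorithm {
  labels : labelling;
  domain_subtree : is_subtree (in_domain labels);
  verdict_iff_leaf : forall s l, labels s = Some l ->
    (is_verdict l <-> is_leaf (in_domain labels) s);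
  halts_everywhere : forall A, halts_on labels A
}.

Definition is_adaptive_k_query (k : nat) (G : adaptive_algorithm) : Prop :=
  forall A s, computation_path (labels G) A s -> size s <= k.

Definition adaptive_decides (G : adaptive_algorithm) (C : digraph_class) : Prop :=
  forall A, C A <-> exists2 s, computation_path (labels G) A s & labels G s = Some YES.

(* Main.v *)
(** A digraph on [n] vertices has a directed cycle iff it admits a walk of length
    [n]; hence query the number of vertices first, then a path of that length.

    Against queries with at most [m] vertices, compare the path with vertices
    [0, ..., 2m] and the digraph obtained from it by redirecting the edge
    leaving [m] to [0].  Neither admits a homomorphism from [F] unless [F] has a
    level function, growing by one along every edge: a homomorphism into the
    redirected path misses a vertex of the cycle, at which the cycle can be cut
    open.  Take such a level function [l] attaining [0] on every component, so
    that [l <= m].  Then exchanging, at each vertex [x] of [F], the values [v]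
    and [v + (m + 1)] for all [v < l x] is an involution on the maps from [F],
    which exchanges the homomorphisms into the two digraphs. *)

Require Import Defs.
From mathcomp Require Import all_boot zify.

Set Implicit Arguments.
Unset Strict Implicit.
Unset Printing Implicit Defensive.

(** Innermost conditions are split first, so that each one handed to [lia] is free of
    conditionals. *)
Ltac split_if :=
  match goal with
  | |- context [if ?b then _ else _] =>
    lazymatch b with
    | context [if _ then _ else _] => fail
    | _ => case: (boolP b) => ?
    end
  end.

Ltac lia_if := repeat split_if; lia.

(** * Homomorphisms and their counts *)

Definition preserves_edges (F A : digraph) (f : F -> A) : Prop :=
  forall x y, edge x y -> edge (f x) (f y).

Lemma is_homP (F A : digraph) (f : {ffun F -> A}) :
  reflect (preserves_edges f) (is_hom f).
Proof.
apply: (iffP forallP) => [H x y | H x]; first by have /forallP/(_ y)/implyP := H x.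
by apply/forallP => y; apply/implyP/H.
Qed.

Lemma hom_gt0P (F A : digraph) :
  reflect (exists f : F -> A, preserves_edges f) (0 < hom F A).
Proof.
rewrite /hom; apply: (iffP card_gt0P) => [[f] | [f Hf]].
  by rewrite inE => /is_homP Hf; exists f.
by exists (finfun f); rewrite inE; apply/is_homP => x y /Hf; rewrite !ffunE.
Qed.

(** * Walks and directed cycles *)

Lemma card_ordS_gt0 n : 0 < #|'I_n.+1|.
Proof. by rewrite card_ord. Qed.

Definition ord_digraph n (e : rel nat) : digraph :=
  @Digraph 'I_n.+1 (fun i j => e i j) (card_ordS_gt0 n).

Definition point_digraph : digraph := ord_digraph 0 (fun _ _ => false).

Definition path_digraph n : digraph := ord_digraph n (fun i j => j == i.+1).

Lemma hom_point (A : digraph) : hom point_digraph A = #|A|.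
Proof.
rewrite /hom (_ : [set f | _] = setT) ?cardsT ?card_ffun ?card_ord ?expn1 //.
by apply/setP => f; rewrite !inE; apply/is_homP.
Qed.

Lemma cycle_of_connect (A : digraph) (x y : A) :
  connect (@edge A) x y -> edge y x -> has_directed_cycle A.
Proof.
case/connectP => p + -> => /shortenP[q Hq uq _] Hyx.
by exists (x :: q); split=> //; rewrite /ucycle /= rcons_path Hq Hyx.
Qed.

(** Going round the cycle again and again gives walks of every length. *)
Lemma cyclic_hom_path (A : digraph) n :
  has_directed_cycle A -> 0 < hom (path_digraph n) A.
Proof.
case=> [[|x p] [//= _ /andP[Hc _]]].
pose w i := iter i (next (x :: p)) x.
have w_in i : w i \in x :: p.
  by elim: i => [|i IH]; rewrite /w ?iterS ?mem_next // mem_head.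
apply/hom_gt0P; exists (fun i : 'I_n.+1 => w i) => i j /eqP /= ->.
exact: next_cycle Hc (w_in i).
Qed.

(** The walk has [n.+1] vertices, more than [A], so it visits some vertex twice and closes up
    between the two visits. *)
Lemma hom_path_cyclic (A : digraph) n :
  #|A| <= n -> 0 < hom (path_digraph n) A -> has_directed_cycle A.
Proof.
move=> len /hom_gt0P[f Hf].
have /injectivePn[i [j neq_ij eq_fij]] : ~~ injectiveb f.
  by apply/negP => /injectiveP/leq_card; rewrite card_ord leqNgt ltnS len.
wlog lt_ij : i j neq_ij eq_fij / i < j.
  move=> W; case: (ltngtP i j) => [||/val_inj]; first exact: W.
    by apply: W; rewrite // eq_sym.
  by move/eqP; rewrite (negPf neq_ij).
have walk k (i' j' : 'I_n.+1) : j' = i' + k :> nat ->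
    connect (@edge A) (f i') (f j').
  elim: k j' => [|k IH] j' Ej.
    by rewrite (_ : i' = j') //; apply: val_inj; rewrite /= Ej addn0.
  have lt_k : i' + k < n.+1 by have := ltn_ord j'; lia.
  apply: connect_trans (IH (Ordinal lt_k) erefl) (connect1 _).
  by apply: Hf; rewrite /= Ej addnS.
(* The last edge, from [f j.-1] to [f j = f i], is the one that closes the cycle. *)
have lt_j : j.-1 < n.+1 by have := ltn_ord j; lia.
apply: (@cycle_of_connect _ (f i) (f (Ordinal lt_j))).
  by apply: (walk (j.-1 - i)) => /=; lia.
by rewrite eq_fij; apply: Hf => /=; lia.
Qed.

(** * The adaptive algorithm *)

Definition cycle_labels : labelling := fun s =>
  match s with
  | [::] => Some (Query point_digraph)
  | [:: n] => Some (Query (path_digraph n))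
  | [:: _; h] => Some (if 0 < h then YES else NO)
  | _ => None
  end.

Lemma cycle_labels_domain s : in_domain cycle_labels s <-> size s <= 2.
Proof. by case: s => [|a [|b [|c s]]]; split. Qed.

Lemma cycle_labels_subtree : is_subtree (in_domain cycle_labels).
Proof.
move=> s t /prefixP[u ->] /cycle_labels_domain; rewrite size_cat => H.
by apply/cycle_labels_domain/leq_trans/H/leq_addr.
Qed.

Lemma cycle_labels_verdict s l : cycle_labels s = Some l ->
  (is_verdict l <-> is_leaf (in_domain cycle_labels) s).
Proof.
have not_leaf u : size u < 2 -> ~ is_leaf (in_domain cycle_labels) u.
  move=> lt_u [_ /(_ (rcons u 0))].
  rewrite prefix_rcons => /(_ _ isT) H.
  have /(congr1 size) : rcons u 0 = u.
    by apply: H; apply/cycle_labels_domain; rewrite size_rcons.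
  by rewrite size_rcons; lia.
case: s => [|a [|b [|//]]] /= [<-].
- by split=> [[]|/(not_leaf [::] isT)].
- by split=> [[]|/(not_leaf [:: a] isT)].
split=> [_|_]; last by case: ifP; [left | right].
split=> // t /cycle_labels_domain le_t /prefixP[u Et].
by case: u Et le_t => [|c u] -> //=; rewrite ?cats0.
Qed.

Lemma cycle_labels_run A n : 2 <= n ->
  run cycle_labels A n = [:: #|A|; hom (path_digraph #|A|) A].
Proof.
case: n => [|[|n]] // _; elim: n => [|n IH].
  by rewrite /run /= /run_step /= hom_point.
by rewrite /run iterS -/(run _ _ n.+2) IH /run_step /=; case: ifP.
Qed.

Lemma cycle_labels_path A s : computation_path cycle_labels A s <->
  s = [:: #|A|; hom (path_digraph #|A|) A].
Proof.
split=> [[n Hn]|->]; last by exists 2 => n; exact: cycle_labels_run.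
by rewrite -(Hn (maxn n 2)) ?leq_maxl // cycle_labels_run ?leq_maxr.
Qed.

Lemma cycle_labels_halt A : halts_on cycle_labels A.
Proof. by eexists; first exact/cycle_labels_path. Qed.

Definition cycle_algorithm : adaptive_algorithm :=
  AdaptiveAlgorithm cycle_labels_subtree cycle_labels_verdict cycle_labels_halt.

Lemma cycle_algorithm_2query : is_adaptive_k_query 2 cycle_algorithm.
Proof. by move=> A s /cycle_labels_path ->. Qed.

Lemma cycle_algorithm_decides :
  adaptive_decides cycle_algorithm has_directed_cycle.
Proof.
move=> A; split=> [HA | [s /cycle_labels_path -> /=]].
  by eexists; first exact/cycle_labels_path; rewrite /= cyclic_hom_path.
by case: ifP => // H _; exact: hom_path_cyclic H.
Qed.

(** * The path and the redirected path *)

Definition redirected_path m : digraph :=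
  ord_digraph (m + m) (fun i j => j == (if i == m then 0 else i.+1)).

(** Values grow along edges, so a cycle through [x] would give [x < x]. *)
Lemma path_digraph_acyclic n : ~ has_directed_cycle (path_digraph n).
Proof.
case=> [[|x p] [//= _ /andP[Hc _]]].
pose lt_val : rel 'I_n.+1 := fun i j => i < j.
have : path lt_val x (rcons p x).
  by apply: sub_path Hc => i j /eqP; rewrite /lt_val /= => ->.
have lt_trans : transitive lt_val by move=> j i k; exact: ltn_trans.
move/(order_path_min lt_trans)/allP/(_ x).
by rewrite mem_rcons mem_head /lt_val ltnn => /(_ isT).
Qed.

Lemma redirected_path_cyclic m : has_directed_cycle (redirected_path m).
Proof.
pose v i : redirected_path m := inord i.
have vE i : i <= m -> v i = i :> nat by move=> le_i; rewrite inordK //; lia.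
have walk k : k <= m -> connect (@edge (redirected_path m)) (v 0) (v k).
  elim: k => [|k IH] // lt_k.
  apply: connect_trans (IH (ltnW lt_k)) (connect1 _).
  by rewrite /= !vE ?(ltnW lt_k) // (ltn_eqF lt_k).
by apply: (cycle_of_connect (walk m _)) => //=; rewrite !vE // eqxx.
Qed.

(** * Level functions *)

Definition level_function (F : digraph) (l : F -> nat) : Prop :=
  forall x y, edge x y -> l y = (l x).+1.

(** These are the unions of weakly connected components. *)
Definition edge_invariant (F : digraph) (S : pred F) : Prop :=
  forall x y, edge x y -> S x = S y.

(* Equivalently, [l] attains 0 on every weakly connected component. *)
Definition grounded (F : digraph) (l : F -> nat) : Prop :=
  forall S : pred F, edge_invariant S -> forall x, S x ->
    exists2 z, S z & l z = 0.

(** While [d] is positive on some nonempty edge-invariant set, lower it by one there; the sum of its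
    values drops, so this ends. *)
Lemma grounded_level_function (F : digraph) (d : F -> nat) :
  level_function d -> exists2 l : F -> nat, level_function l & grounded l.
Proof.
have [s] := ubnP (\sum_x d x); elim: s d => // s IH d le_s Hd.
pose lifted (S : {set F}) := [&& S != set0,
  [forall x, forall y, edge x y ==> ((x \in S) == (y \in S))] &
  [forall z in S, 0 < d z]].
case: (pickP lifted) => [S /and3P[/set0Pn[x0 Sx0] /forallP invS /forall_inP posS]
                        | none].
  apply: (IH (fun x => d x - (x \in S))).
    apply: leq_trans (le_s : \sum_x d x <= s).
    rewrite (bigD1 x0) //= [X in _ < X](bigD1 x0) //= Sx0.
    rewrite -addSn leq_add //; first by have := posS _ Sx0; lia.
    by apply: leq_sum => x _; exact: leq_subr.
  move=> x y exy; have /forallP/(_ y)/implyP/(_ exy)/eqP Exy := invS x.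
  rewrite (Hd _ _ exy) -Exy; case: (boolP (x \in S)) => [/posS|_]; lia.
exists d => // S invS x Sx; have /negbT := none [set x in S].
rewrite !negb_and negbK => /or3P[/eqP/setP/(_ x)||].
- by rewrite !inE [_ \in _]Sx.
- case/forallPn=> a /forallPn[b]; rewrite negb_imply => /andP[/invS Eab].
  by rewrite !inE -!topredE /= Eab eqxx.
case/forallPn=> z; rewrite negb_imply inE lt0n negbK => /andP[Sz /eqP dz].
by exists z.
Qed.

Lemma exists_missed_value (T : finType) (h : T -> nat) m :
  #|T| <= m -> exists2 c, c <= m & forall x, h x <> c.
Proof.
(* Values above [m] are sent to 0 by [inord]. This may hide that 0 is missed, but some value is
   still outside the image of [g]. *)
move=> le_T; pose g x : 'I_m.+1 := inord (h x).
case: (pickP [pred c | c \notin codom g]) => [c /= nc | all_hit].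
  exists (c : nat); first by rewrite -ltnS.
  move=> x Ex; case/negP: nc; apply/codomP; exists x.
  by rewrite /g Ex inord_val.
have : #|'I_m.+1| <= #|codom g|.
  by apply/subset_leq_card/subsetP => c _; have /negbFE := all_hit c.
by move/leq_trans/(_ (leq_image_card g _)); rewrite card_ord ltnNge le_T.
Qed.

(** Levels rise by one along edges and cannot step over a missed value [c], so the vertices above
    level [c] form an edge-invariant set without a zero of [l]; it is empty. *)
Lemma grounded_bound (F : digraph) (l : F -> nat) x :
  level_function l -> grounded l -> l x <= #|F|.
Proof.
move=> Hl gl; have [c le_c Hc] := exists_missed_value l (leqnn #|F|).
rewrite leqNgt; apply/negP => lt_x.
have [||z] := gl (fun y => c < l y) _ x; last by lia.
- by move=> a b /Hl Eb; have := Hc a; have := Hc b; lia.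
- lia.
Qed.

Lemma path_hom_level n (F : digraph) (f : F -> path_digraph n) :
  preserves_edges f -> level_function (fun x => f x : nat).
Proof. by move=> Hf x y /Hf/eqP. Qed.

(** The cycle is cut open at a missed vertex [c]: the vertices before [c] are placed after [m], so
    that the edge from [m] to 0 also climbs by one. *)
Lemma redirected_path_hom_level m (F : digraph) (g : F -> redirected_path m) :
  #|F| <= m -> preserves_edges g -> exists d : F -> nat, level_function d.
Proof.
move=> le_F Hg.
have [c le_c Hc] := exists_missed_value (fun x => g x : nat) le_F.
exists (fun x => if g x < c then g x + m.+1 else g x) => x y /Hg/eqP /=.
have := Hc x; have := Hc y; move: (g x : nat) (g y : nat) => a b.
by lia_if.
Qed.

(** * The exchange of homomorphisms *)

Definition shift_swap m l v :=
  if v < l then v + m.+1 else if m < v <= m + l then v - m.+1 else v.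

Lemma shift_swapK m l : l <= m -> involutive (shift_swap m l).
Proof. by move=> le_l v; rewrite /shift_swap; lia_if. Qed.

(** Values move up to at most [m + l], hence the last vertex [m + m]. *)
Lemma shift_swap_ord m l v :
  l <= m -> v < (m + m).+1 -> shift_swap m l v < (m + m).+1.
Proof. by move=> le_l lt_v; rewrite /shift_swap; lia_if. Qed.

Section LevelSwap.

Variables (m : nat) (F : digraph) (l : F -> nat).
Hypotheses (le_F : #|F| <= m) (Hl : level_function l) (gl : grounded l).

Let le_l x : l x <= m := leq_trans (grounded_bound x Hl gl) le_F.

Definition level_swap (f : {ffun F -> 'I_(m + m).+1}) :
    {ffun F -> 'I_(m + m).+1} :=
  [ffun x => inord (shift_swap m (l x) (f x))].

Lemma level_swapE f x : level_swap f x = shift_swap m (l x) (f x) :> nat.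
Proof. by rewrite ffunE inordK // shift_swap_ord. Qed.

Lemma level_swapK : involutive level_swap.
Proof.
move=> f; apply/ffunP => x; apply: val_inj.
by rewrite /= !level_swapE shift_swapK.
Qed.

(** The difference of [f] and [l] is constant along edges; compare [x] with a zero of [l] at which
    it is the same. *)
Lemma path_hom_ge_level (f : F -> path_digraph (m + m)) x :
  preserves_edges f -> l x <= f x.
Proof.
move=> /path_hom_level Hf.
have [|| z /eqP] := gl (S := fun y => f y + l x == f x + l y) _ (x := x) => //.
  by move=> a b eab; rewrite (Hf _ _ eab) (Hl eab); lia.
by lia.
Qed.

(** No edge of the redirected path joins the vertices up to [m] to those beyond. So [m < g y] is
    edge-invariant, and a zero of [l] with the same difference of [g] and [l] lies beyond [m]
    too. *)
Lemma redirected_path_hom_gt_level (g : F -> redirected_path m) x :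
  preserves_edges g -> m < g x -> m + l x < g x.
Proof.
move=> Hg lt_x.
have [|| z /andP[lt_z /eqP Ez] lz] :=
    gl (S := fun y => (m < g y) && (g y + l x == g x + l y)) _ (x := x).
- move=> a b eab; have /eqP /= := Hg _ _ eab; rewrite (Hl eab).
  move: (g a : nat) (g b : nat) => u v; lia_if.
- by rewrite lt_x eqxx.
lia.
Qed.

(** Since [l x <= f x], values only move down. The ends of an edge move together or stay together,
    except when [f x = m]: then only the head moves, to 0, which gives the redirected edge. *)
Lemma level_swap_path_hom f :
  is_hom (F := F) (A := path_digraph (m + m)) f ->
  is_hom (F := F) (A := redirected_path m) (level_swap f).
Proof.
move/is_homP=> Hf; apply/is_homP => x y exy /=; apply/eqP.
rewrite !level_swapE (Hl exy) (path_hom_level Hf exy).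
have := path_hom_ge_level x Hf; have := le_l y; rewrite (Hl exy) /shift_swap.
by move: (f x : nat) => v; lia_if.
Qed.

(** Values beyond [m] exceed [m + l x] and stay, so values only move up. On the edge from [m] to 0
    only the head moves, to [m.+1]. *)
Lemma level_swap_redirected_path_hom g :
  is_hom (F := F) (A := redirected_path m) g ->
  is_hom (F := F) (A := path_digraph (m + m)) (level_swap g).
Proof.
move/is_homP=> Hg; apply/is_homP => x y exy /=; apply/eqP.
have /eqP /= := Hg _ _ exy; have := redirected_path_hom_gt_level (x := x) Hg.
rewrite !level_swapE; have := le_l y; rewrite (Hl exy) /shift_swap.
by move: (g x : nat) (g y : nat) => u v; lia_if.
Qed.

Lemma hom_path_redirected_level :
  hom F (path_digraph (m + m)) = hom F (redirected_path m).
Proof.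
rewrite /hom -(card_imset _ (inv_inj level_swapK)); apply: eq_card => g.
rewrite inE; apply/imsetP/idP => [[f] | Hg].
  by rewrite inE => /level_swap_path_hom Hf ->.
exists (level_swap g); last by rewrite level_swapK.
by rewrite inE; exact: level_swap_redirected_path_hom.
Qed.

End LevelSwap.

(** * Failure of non-adaptive algorithms *)

Lemma hom_path_redirected (F : digraph) m : #|F| <= m ->
  hom F (path_digraph (m + m)) = hom F (redirected_path m).
Proof.
move=> le_F.
have from_level (d : F -> nat) : level_function d ->
    hom F (path_digraph (m + m)) = hom F (redirected_path m).
  by case/grounded_level_function => l; exact: hom_path_redirected_level.
case: (posnP (hom F (path_digraph (m + m)))) => [E0 | /hom_gt0P[f Hf]]; last first.
  exact: from_level (path_hom_level Hf).
case: (posnP (hom F (redirected_path m))) => [-> // | /hom_gt0P[g Hg]].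
by have [d /from_level] := redirected_path_hom_level le_F Hg.
Qed.

Lemma cycle_not_nonadaptive k (N : nonadaptive_algorithm k) :
  ~ nonadaptive_decides N has_directed_cycle.
Proof.
(* With [m] bounding the sizes of all queries, one pair of digraphs gives equal answers to each of
   them. *)
move=> HN; pose m := \max_(i < k) #|queries N i|.
apply: (@path_digraph_acyclic (m + m)); apply/HN.
have /HN := redirected_path_cyclic m.
rewrite (_ : [tuple _ | i < k] =
  [tuple hom (queries N i) (path_digraph (m + m)) | i < k]) //.
apply: eq_from_tnth => i; rewrite !tnth_mktuple hom_path_redirected //.
exact: leq_bigmax.
Qed.

Theorem theorem18 :
  (exists G : adaptive_algorithm,
      is_adaptive_k_query 2 G /\ adaptive_decides G has_directed_cycle) /\
  (forall k : nat,
      ~ exists N : nonadaptive_algorithm k,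
          nonadaptive_decides N has_directed_cycle).
Proof.
split; last by move=> k [N /cycle_not_nonadaptive].
by exists cycle_algorithm; split;
  [exact: cycle_algorithm_2query | exact: cycle_algorithm_decides].
Qed.
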